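(* Let $X$ be a set, let $Y$ be a nonempty subset of $X$, let $\mathbb{S}(Y)$ be a subsemigroup of $T(Y)$ such that $I_Y\in\mathbb{S}(Y)$, and let $f\in T_{\mathbb{S}(Y)}(X)$. Then $f$ is a unit-regular element of $T_{\mathbb{S}(Y)}(X)$ if and only if all of the following hold: (i) $f_{\upharpoonright_Y}$ is a unit-regular element of $\mathbb{S}(Y)$; (ii) $R(f)\cap Y=R(f_{\upharpoonright_Y})$; (iii) there exist transversals $T_f$ of $\ker(f)$ and $T_{(f_{\upharpoonright_Y})}$ of $\ker(f_{\upharpoonright_Y})$ with $Y\cap T_f=T_{(f_{\upharpoonright_Y})}$ such that, writing $C(f)=X\setminus T_f$ and $C(f_{\upharpoonright_Y})=Y\setminus T_{(f_{\upharpoonright_Y})}$, one has $|C(f)\setminus C(f_{\upharpoonright_Y})|=|D(f)\setminus D(f_{\upharpoonright_Y})|$.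
   Context: For a set $A$, $T(A)$ is the semigroup of all maps $A\to A$ under composition (composed from left to right, with $xf$ denoting the image of $x$ under $f$), and $I_A$ is the identity map on $A$. For $f\in T(X)$ with $Yf\subseteq Y$, $f_{\upharpoonright_Y}\in T(Y)$ denotes the map $Y\to Y$ that agrees with $f$ on $Y$. Define $T_{\mathbb{S}(Y)}(X)=\{f\in T(X) : Yf\subseteq Y \text{ and } f_{\upharpoonright_Y}\in\mathbb{S}(Y)\}$, a subsemigroup of $T(X)$; it contains $I_X$ when $I_Y\in\mathbb{S}(Y)$. For a map $h\colon A\to A$: $R(h)$ is its image, $D(h)=A\setminus R(h)$, and $\ker(h)=\{(x,y)\in A\times A : xh=yh\}$, an equivalence relation on $A$ (so $D(f)=X\setminus R(f)$ and $D(f_{\upharpoonright_Y})=Y\setminus R(f_{\upharpoonright_Y})$). A transversal of an equivalence relation on $A$ is a subset of $A$ containing exactly one element of each class. $|\cdot|$ denotes cardinality. In a semigroup $S$ with identity, $U(S)$ is the set of units of $S$, and $a\in S$ is unit-regular if there is $u\in U(S)$ with $aua=a$. *)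

(* Defs.v *)
From mathcomp Require Import all_boot.
From mathcomp Require Import boolp classical_sets functions cardinality.

Set Implicit Arguments.
Unset Strict Implicit.
Unset Printing Implicit Defensive.

Local Open Scope classical_set_scope.

(* T(A) is the function type [A -> A]. Maps act on the right, so the product
   of f and g is [f \; g], with (f \; g) x = g (f x). A subset Y of X is a
   [set X]; used as a type, Y denotes {x : X | x \in Y}, so T(Y) is [Y -> Y],
   and subsets of that subtype are moved into X by [val @` _]. *)

Definition subsemigroup (A : Type) (S : set (A -> A)) : Prop :=
  S !=set0 /\ forall f g : A -> A, S f -> S g -> S (f \; g).

(* The semigroups considered contain I_A = idfun, which is then their
   identity. *)
Definition units (A : Type) (S : set (A -> A)) : set (A -> A) :=
  [set u | S u /\ exists v, [/\ S v, u \; v = idfun & v \; u = idfun]].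

Definition unit_regular (A : Type) (S : set (A -> A)) (a : A -> A) : Prop :=
  S a /\ exists u, units S u /\ (a \; u) \; a = a.

Definition restr (X : Type) (Y : set X) (f : X -> X) (fY : set_fun Y Y f) :
  Y -> Y := fun y => SigSub (mem_set (fY (val y) (set_valP y))).

Definition TS (X : Type) (Y : set X) (S : set (Y -> Y)) : set (X -> X) :=
  [set f | exists fY : set_fun Y Y f, S (restr fY)].

Lemma TS_set_fun (X : Type) (Y : set X) (S : set (Y -> Y)) (f : X -> X) :
  TS S f -> set_fun Y Y f.
Proof. by case. Qed.

Definition defect (A : Type) (h : A -> A) : set A := ~` range h.

Definition kernel_rel (A : Type) (h : A -> A) : set (A * A) :=
  [set p | h p.1 = h p.2].

Definition transversal_of (A : Type) (E : set (A * A)) (T : set A) : Prop :=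
  forall x : A, exists! t, (T `&` [set y | E (x, y)]) t.

(* Main.v *)
(* If u is a unit with f u f = f, then u carries R(f) onto a transversal of
   ker(f) and R(f|Y) onto a transversal of ker(f|Y), and, as it preserves both Y
   and its complement, it carries D(f) \ D(f|Y) onto C(f) \ C(f|Y). Conversely,
   glue three bijections into u: a unit of S(Y) on Y, the inverse of
   f : T_f \ Y -> R(f) \ Y, and a bijection from
   D(f) \ D(f|Y) = X \ (Y u R(f)) to C(f) \ C(f|Y) = X \ (Y u T_f). *)
Require Import Defs.
From mathcomp Require Import all_boot.
From mathcomp Require Import boolp classical_sets functions cardinality.

Local Open Scope classical_set_scope.
Local Open Scope card_scope.

(** Lets a bijection be glued from pieces given as a relation: choice picks [u] and [v] inside [G],
    and the two uniqueness conditions force them to be mutually inverse. *)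
Lemma bijection_of_graph (A B : Type) (G : A -> B -> Prop) :
  (forall x, exists z, G x z) -> (forall z, exists x, G x z) ->
  (forall x z z', G x z -> G x z' -> z = z') ->
  (forall x x' z, G x z -> G x' z -> x = x') ->
  exists u v, [/\ cancel u v, cancel v u & forall x, G x (u x)].
Proof.
move=> Gl Gr Gfun Ginj.
have [u Gu] := choice Gl; have [v Gv] := choice Gr.
exists u, v; split=> // [x|z].
- exact: Ginj (Gv _) (Gu _).
- exact: Gfun (Gu _) (Gv _).
Qed.

(** Trades the dependent [restr] for any self-map of [Y] that agrees with [g] there; such a map is
    unique because [val] is injective. *)
Lemma TSP (X : Type) (Y : set X) (S : set (Y -> Y)) (g : X -> X) :
  TS S g <-> exists2 h : Y -> Y, S h & forall y, g (val y) = val (h y).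
Proof.
split=> [[gY Sg]|[h Sh gh]]; first by exists (restr gY).
have gY : set_fun Y Y g.
  move=> x Yx; have -> : x = val (SigSub (mem_set Yx) : Y) by [].
  by rewrite gh; exact: set_valP.
exists gY; suff -> : restr gY = h by [].
by apply/funext => y; apply: val_inj; rewrite -gh.
Qed.

(** Applied to both sides of (iii), with [P] a transversal or the range of [f] and [Q] its trace on
    [Y]: what is removed is exactly the part of the complement of [P] lying in [Y]. *)
Lemma setDCval (X : Type) (Y P : set X) (Q : set Y) :
  Y `&` P = val @` Q -> ~` P `\` (val @` (~` Q)) = ~` (Y `|` P).
Proof.
move=> YPQ; apply/seteqP; split=> [x [nPx nQx] [Yx|//]|x nYPx].
- apply: nQx; exists (SigSub (mem_set Yx)) => // Qx.
  have : (Y `&` P) x by rewrite YPQ; exists (SigSub (mem_set Yx)).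
  by case.
- split=> [Px|[y _ yx]]; apply: nYPx; first by right.
  by left; rewrite -yx; exact: set_valP.
Qed.

(** The representative of [x] is [u (f x)]; a point [u (f z)] in the class of [x] satisfies
    [f x = f (u (f z)) = f z], hence equals it. *)
Lemma transversal_range (A : Type) (f u : A -> A) :
  (f \; u) \; f = f -> transversal_of (kernel_rel f) (u @` range f).
Proof.
move=> fuf x; have fufE z : f (u (f z)) = f z := congr1 (@^~ z) fuf.
exists (u (f x)); split; first by split; [exists (f x) => //; exists x|by rewrite /kernel_rel /= fufE].
by move=> _ [[_ [z _ <-] <-]]; rewrite /kernel_rel /= fufE => ->.
Qed.

Theorem theorem3p6 (X : Type) (Y : set X) (Y0 : Y !=set0)
    (S : set (Y -> Y)) (Ssg : subsemigroup S) (Sid : S idfun)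
    (f : X -> X) (fS : TS S f) :
  let fY : Y -> Y := restr (TS_set_fun fS) in
  unit_regular (TS S) f <->
  [/\ unit_regular S fY,
      range f `&` Y = val @` range fY &
      exists (Tf : set X) (TfY : set Y),
        [/\ transversal_of (kernel_rel f) Tf,
            transversal_of (kernel_rel fY) TfY,
            Y `&` Tf = val @` TfY &
            ~` Tf `\` (val @` (~` TfY)) #=
            defect f `\` (val @` defect fY)]].
Proof.
move=> fY; have fYE y : f (val y) = val (fY y) by []. clearbody fY.
have valY (y : Y) : Y (val y) by exact: set_valP.
have Yval x : Y x -> exists y : Y, x = val y.
  by move=> Yx; exists (SigSub (mem_set Yx)).
have SfY : S fY.
  have [h Sh fh] := (TSP _ _ _ _).1 fS.
  suff -> : fY = h by [].
  by apply/funext => y; apply: val_inj; rewrite -fh.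
split.
- move=> [_ [u [[/TSP[hu Su uE] [v [/TSP[hv Sv vE] uv vu]]] fuf]]].
  have uK : cancel u v := fun x => congr1 (@^~ x) uv.
  have vK : cancel v u := fun x => congr1 (@^~ x) vu.
  have fufE z : f (u (f z)) = f z := congr1 (@^~ z) fuf.
  have fufY : (fY \; hu) \; fY = fY.
    apply/funext => y; apply: val_inj => /=.
    by rewrite -fYE -uE -fYE fufE.
  (* The inverse [v] also maps [Y] into itself, so [u] preserves the complement of [Y]. *)
  have Yu x : Y (u x) -> Y x.
    by move=> /Yval[y uxy]; rewrite -(uK x) uxy vE; exact: valY.
  have rangefY : range f `&` Y = val @` range fY.
    apply/seteqP; split=> [_ [[z _ <-] /Yval[y zy]]|_ [_ [y _ <-] <-]].
      exists (fY (hu y)); first by exists (hu y).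
      by rewrite -fYE -uE -zy fufE.
    by split; [exists (val y)|exact: valY].
  have YuR : Y `&` u @` range f = val @` (hu @` range fY).
    apply/seteqP; split=> [x [Yx [z Rz zx]]|_ [_ [y Ry <-] <-]].
      have : (range f `&` Y) z by split=> //; apply: Yu; rewrite zx.
      rewrite rangefY => -[y Ry yx].
      by exists (hu y); [exists y|rewrite -uE yx].
    split; first exact: valY.
    have : (range f `&` Y) (val y) by rewrite rangefY; exists y.
    by move=> [Rfy _]; exists (val y); rewrite ?uE.
  split=> //.
    split=> //; exists hu; split=> //; split=> //; exists hv; split=> //.
      by apply/funext => y; apply: val_inj; rewrite /= -vE -uE uK.
    by apply/funext => y; apply: val_inj; rewrite /= -uE -vE vK.
  exists (u @` range f), (hu @` range fY); split=> //.
  + exact: transversal_range.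
  + exact: transversal_range.
  rewrite (setDCval _ _ _ _ YuR) setDCval; last by rewrite setIC.
  (* As a bijection with [u x] in [Y] exactly when [x] is, [u] commutes with taking this complement,
     and its injectivity gives the equality of cardinals. *)
  have -> : ~` (Y `|` u @` range f) = u @` (~` (Y `|` range f)).
    apply/seteqP; split=> [x nx|_ [x nx <-] [/Yu Yx|[x' Rx' /(can_inj uK) xx']]].
    - exists (v x); last exact: vK.
      move=> [/Yval[y vxy]|Rvx]; apply: nx.
        by left; rewrite -(vK x) vxy uE; exact: valY.
      by right; exists (v x).
    - by apply: nx; left.
    - by apply: nx; right; rewrite -xx'.
  by apply: inj_card_eq => x x' _ _ /(can_inj uK).
- move=> [[_ [uY [[SuY [vY [SvY uvY vuY]]] fufY]]] RfY [Tf [TfY]]].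
  move=> [trf trfY YTf card_eq_CD].
  have uYK : cancel uY vY := fun x => congr1 (@^~ x) uvY.
  have vYK : cancel vY uY := fun x => congr1 (@^~ x) vuY.
  move: card_eq_CD.
  rewrite (setDCval _ _ _ _ YTf) setDCval; last by rewrite setIC.
  move=> /card_bijP[g [g' gK g'K]].
  have T_inj t t' : Tf t -> Tf t' -> f t = f t' -> t = t'.
    move=> Tt Tt' tt'; have [s [_ s_uniq]] := trf t.
    by rewrite -(s_uniq t) // -(s_uniq t').
  have T_ex x : exists2 t, Tf t & f t = f x.
    by have [t [[Tt fxt] _]] := trf x; exists t.
  (* Hence [f] maps [Tf] outside [Y] into the range outside [Y]. By (ii), [f t] is [fY y] for some
     [y]; the representative of [y] in [TfY] also lies in [Tf], so it is [t]. *)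
  have YTft t : Tf t -> Y (f t) -> Y t.
    move=> Tt Yft; have : (range f `&` Y) (f t) by split=> //; exists t.
    rewrite RfY => -[_ [y _ <-] yt].
    have [s [[Ts ys] _]] := trfY y.
    have [Ys Tfs] : (Y `&` Tf) (val s) by rewrite YTf; exists s.
    suff -> : t = val s by [].
    by apply: T_inj => //; rewrite fYE -ys yt.
  (* The graph of the glued unit. The middle clause inverts [f] on [Tf] outside [Y]; in the last,
     [g] runs from the complement on the transversal side to that on the range side, so [u] follows
     its inverse. *)
  pose G x z := [\/ exists2 y, x = val y & z = val (uY y),
                    [/\ ~ Y x, Tf z & f z = x] |
                    exists2 a, x = val (g a) & z = val a].
  have gP a : ~ Y (val (g a)) /\ ~ range f (val (g a)).
    by apply/not_orP; exact: (set_valP (g a)).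
  have aP (a : ~` (Y `|` Tf)) : ~ Y (val a) /\ ~ Tf (val a).
    by apply/not_orP; exact: (set_valP a).
  (* Rules out, in the injectivity of [G], a clash between the first two clauses. *)
  have GY x z : G x z -> Y x <-> Y z.
    case=> [[y -> ->]|[nYx Tz zx]|[a -> ->]].
    - by split=> _; exact: valY.
    - split=> // Yz; case: nYx; rewrite -zx.
      by have [y ->] := Yval _ Yz; rewrite fYE; exact: valY.
    - by split=> [/(gP a).1|/(aP a).1].
  have [||||u [v [uK vK Gu]]] := @bijection_of_graph X X G.
  + move=> x; have [/Yval[y ->]|nYx] := pselect (Y x).
      by exists (val (uY y)); constructor 1; exists y.
    have [[z _ zx]|nRx] := pselect (range f x).
      by have [t Tt tz] := T_ex z; exists t; constructor 2; rewrite tz.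
    have /mem_set Dx : (~` (Y `|` range f)) x by case.
    exists (val (g' (SigSub Dx))); constructor 3.
    by exists (g' (SigSub Dx)); rewrite ?g'K.
  + move=> z; have [/Yval[y ->]|nYz] := pselect (Y z).
      by exists (val (vY y)); constructor 1; exists (vY y); rewrite ?vYK.
    have [Tz|nTz] := pselect (Tf z).
      by exists (f z); constructor 2; split=> // /(YTft _ Tz).
    have /mem_set Cz : (~` (Y `|` Tf)) z by case.
    by exists (val (g (SigSub Cz))); constructor 3; exists (SigSub Cz).
  + move=> x z z' [[y -> ->]|[nYx Tz zx]|[a -> ->]].
    - case=> [[y' /val_inj -> ->//]|[/(_ (valY y))//]|[a ya]].
      by case: (gP a).1; rewrite -ya; exact: valY.
    - case=> [[y xy]|[_ Tz' z'x]|[a xa]].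
      + by case: nYx; rewrite xy; exact: valY.
      + by apply: T_inj => //; rewrite zx.
      + by case: (gP a).2; rewrite -xa -zx; exists z.
    - case=> [[y ay]|[_ _ z'a]|[a' /val_inj /(can_inj gK) -> -> //]].
      + by case: (gP a).1; rewrite ay; exact: valY.
      + by case: (gP a).2; rewrite -z'a; exists z'.
  + move=> x x' z Gxz Gx'z.
    have [Yzx Yzx'] := (iffRL (GY _ _ Gxz), iffRL (GY _ _ Gx'z)).
    case: Gxz Gx'z Yzx Yzx' => [[y -> ->]|[nYx Tz zx]|[a -> ->]].
    - case=> [[y' -> /val_inj /(can_inj uYK) ->//]|[nYx' _ _]|[a -> ay]].
        by move=> _ /(_ (valY _)).
      by case: (aP a).1; rewrite -ay; exact: valY.
    - case=> [[y _ ->]|[_ _ <-//]|[a _ za]].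
        by move=> /(_ (valY _)).
      by case: (aP a).2; rewrite -za.
    - case=> [[y _ ay]|[_ Ta _]|[a' -> /val_inj ->//]].
        by case: (aP a).1; rewrite ay; exact: valY.
      by case: (aP a).2.
  have uE y : u (val y) = val (uY y).
    have := Gu (val y); case=> [[y' /val_inj -> //]|[/(_ (valY y))//]|[a ya]].
    by case: (gP a).1; rewrite -ya; exact: valY.
  (* Needed for [v] to belong to [TS S]: being inverse to [u], it must extend [vY]. *)
  have vE y : v (val y) = val (vY y) by rewrite -{1}(vYK y) -uE uK.
  split=> //; exists u; split.
    split; first by apply/TSP; exists uY.
    exists v; split; [by apply/TSP; exists vY|exact/funext|exact/funext].
  apply/funext => x /=.
  (* Inside [Y], (ii) reduces the claim to [fufY]. Outside, the middle clause of [G] at [f x] is the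
     claim itself, and the last one is excluded since [f x] is in the range. *)
  have [Yfx|nYfx] := pselect (Y (f x)).
    have : (range f `&` Y) (f x) by split=> //; exists x.
    rewrite RfY => -[_ [y _ <-] <-].
    by rewrite uE fYE; congr val; exact: (congr1 (@^~ y) fufY).
  have [[y fxy]|[_ _ //]|[a fxa]] := Gu (f x).
    by case: nYfx; rewrite fxy; exact: valY.
  by case: (gP a).2; rewrite -fxa; exists x.
Qed.
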